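(* Let $\mathcal{H}$ be a real Hilbert space, let $I=\{1,2,\ldots,m\}$, and let $C_1,C_2,\ldots,C_m\subseteq\mathcal{H}$ be closed and convex sets with $\operatorname{int}\bigcap_{i\in I}C_i\neq\emptyset$. For $t=1,2,\ldots,M$ let the string $I_t=(i_1^t,i_2^t,\ldots,i_{\gamma(t)}^t)$ be an ordered finite nonempty subset of $I$ with $\gamma(t)$ elements, such that $I=I_1\cup I_2\cup\cdots\cup I_M$. Let $w_1,\ldots,w_M>0$ with $\sum_{t=1}^M w_t=1$. Define the string operators $$T_t:=T_{i_{\gamma(t)}^t,i_1^t}\,T_{i_{\gamma(t)-1}^t,i_{\gamma(t)}^t}\cdots T_{i_2^t,i_3^t}\,T_{i_1^t,i_2^t},\qquad t=1,2,\ldots,M,$$ where $T_{i,j}$ denotes the 2-set-Douglas-Rachford operator $T_{C_i,C_j}$. Then for any $x^0\in\mathcal{H}$, the sequence $\{x^k\}_{k=0}^\infty$ generated by $$x^{k+1}=\sum_{t=1}^{M}w_tT_t(x^k),\qquad k=0,1,2,\ldots$$ (the String-Averaging Douglas-Rachford algorithm) converges strongly to a point $x^*\in\bigcap_{i\in I}C_i$.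
   Context: For a nonempty closed convex set $A\subseteq\mathcal{H}$, $P_A$ is the orthogonal (nearest point, metric) projection onto $A$ and $R_A:=2P_A-\mathrm{Id}$ is the reflection operator into $A$, where $\mathrm{Id}$ is the identity. For nonempty closed convex sets $A,B\subseteq\mathcal{H}$, the 2-set-Douglas-Rachford operator is $T_{A,B}:=\frac12(\mathrm{Id}+R_BR_A):\mathcal{H}\to\mathcal{H}$ (reflect first into $A$, then into $B$, then take the midpoint with the original point). Juxtaposition of operators denotes composition, the rightmost being applied first. If $\gamma(t)=1$, then $T_t=T_{i_1^t,i_1^t}$. *)

(* Defs.v *)
From HB Require Import structures.
From mathcomp Require Import all_boot all_order all_algebra.
From mathcomp Require Import all_classical all_reals all_analysis.

Set Implicit Arguments.
Unset Strict Implicit.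
Unset Printing Implicit Defensive.

Import Order.TTheory GRing.Theory Num.Theory.
Import numFieldNormedType.Exports.

Local Open Scope classical_set_scope.
Local Open Scope ring_scope.

(* A real Hilbert space: a complete normed space whose norm comes from an inner
   product, i.e. from a symmetric positive definite bilinear form. *)
HB.mixin Record CompleteNormedModule_isHilbert (R : realType) H
    of CompleteNormedModule R H := {
  inner : {dot H for @idfun R} ;
  innerE : forall x : H, inner x x = `|x| ^+ 2
}.

#[short(type="hilbertType")]
HB.structure Definition Hilbert (R : realType) :=
  {H of CompleteNormedModule_isHilbert R H & CompleteNormedModule R H}.

Section DouglasRachford.
Context {R : realType} {H : hilbertType R}.
Implicit Types (A B : set H) (x : H).

Definition nearest_points A x : set H :=
  [set p | A p /\ forall a, A a -> `|x - p| <= `|x - a|].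

(* When A is nonempty, closed and convex, [nearest_points A x] is a singleton
   and [proj A x] is its element; the default value 0 is then not used. *)
Definition proj A x : H := xget 0 (nearest_points A x).

Definition reflection A x : H := 2 *: proj A x - x.

Definition DR A B x : H := 2^-1 *: (x + reflection B (reflection A x)).

(* For s = [:: i_1; ...; i_g], [zip s (rot 1 s)] is the list of the cyclically
   consecutive pairs (i_1, i_2), ..., (i_(g-1), i_g), (i_g, i_1), and [foldl]
   applies the operator of the first pair first. *)
Definition string_DR m (C : 'I_m -> set H) (s : seq 'I_m) x : H :=
  foldl (fun y ij => DR (C ij.1) (C ij.2) y) x (zip s (rot 1 s)).

End DouglasRachford.

(* Main.v *)
(* Every Douglas-Rachford operator of a pair (C_i, C_j) is firmly nonexpansive
   and fixes the common points of the C_i. Hence the averaged string operator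
   is nonexpansive and its iterates are Fejer monotone with respect to the
   intersection of the C_i; as this set has interior points, they converge in
   norm, to a fixed point l. For a common point c, each string operator
   keeps l at distance at most |l - c| of c, while their mean l is at distance
   exactly |l - c|, so that no Douglas-Rachford step decreases the distance to
   c, and by firm nonexpansiveness every step fixes l. Because the intersection
   of C_i and C_j has interior points, the fixed points of a step are exactly
   the common points of C_i and C_j, so l lies in every C_i. *)
Require Import Defs.
From HB Require Import structures.
From mathcomp Require Import all_boot all_order all_algebra.
From mathcomp Require Import all_classical all_reals all_analysis.
From mathcomp Require Import ring lra.

Set Implicit Arguments.
Unset Strict Implicit.
Unset Printing Implicit Defensive.

Import Order.TTheory GRing.Theory Num.Theory.
Import numFieldNormedType.Exports.

Local Open Scope classical_set_scope.
Local Open Scope ring_scope.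

(* [proj] alone would be the coordinate projection of MathComp-Analysis. *)
Local Notation proj := Defs.proj.

Section Hilbert.
Context {R : realType} {H : hilbertType R}.
Implicit Types (A B S : set H) (a b c x y z : H) (u : nat -> H).

(** * Inner product identities and existence of nearest points *)

Lemma inner_sym x y : inner x y = inner y x.
Proof. by rewrite (hermC inner) expr0 mul1r. Qed.

Lemma sqr_normD x y :
  `|x + y| ^+ 2 = `|x| ^+ 2 + 2 * inner x y + `|y| ^+ 2.
Proof.
by rewrite -!innerE linearDl !linearDr /= (inner_sym y x); ring.
Qed.

Lemma sqr_normB x y :
  `|x - y| ^+ 2 = `|x| ^+ 2 - 2 * inner x y + `|y| ^+ 2.
Proof. by rewrite sqr_normD linearNr normrN mulrN. Qed.

Lemma cauchy_seq_cvg u :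
  (forall e, 0 < e -> exists N, forall k, (N <= k)%N -> `|u N - u k| < e) ->
  cvgn u.
Proof.
move=> uC; apply/cauchy_cvgP/cauchy_exP => e /uC[N uN].
exists (u N); exists N => //= k /= Nk.
by rewrite -ball_normE /=; exact: uN.
Qed.

Lemma convex_setE A : convex_set A -> forall a b (l : R), 0 <= l -> l <= 1 ->
  A a -> A b -> A (l *: a + (1 - l) *: b).
Proof.
move=> cA a b l l0 l1 Aa Ab.
by have /= := cA a b (Itv01 l0 l1); rewrite !inE => /(_ Aa Ab).
Qed.

(* By the parallelogram law, points of A whose squared distances to x are
   within d and d' of the infimum are at squared distance at most
   2 * d + 2 * d' of each other. *)
Lemma nearest_points_neq0 A x :
  A !=set0 -> closed A -> convex_set A -> nearest_points A x !=set0.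
Proof.
move=> [a0 Aa0] clA cA.
pose D : set R := [set `|x - a| ^+ 2 | a in A].
have Dinf : has_inf D.
  split; first by exists (`|x - a0| ^+ 2), a0.
  by exists 0 => _ [a _ <-]; rewrite sqr_ge0.
have Dlb a : A a -> inf D <= `|x - a| ^+ 2.
  by move=> Aa; apply: (ge_inf Dinf.2); exists a.
have /choice[u uP] : forall n, exists a,
    A a /\ `|x - a| ^+ 2 < inf D + n.+1%:R^-1.
  move=> n; have n0 : 0 < (n.+1%:R^-1 : R) by rewrite invr_gt0.
  by have [_ [a Aa <-] ?] := inf_adherent n0 Dinf; exists a.
have uuk j k : `|u j - u k| ^+ 2 <= 2 * j.+1%:R^-1 + 2 * k.+1%:R^-1.
  have half1 : (1 - 2^-1 : R) = 2^-1 by lra.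
  have /Dlb : A (2^-1 *: u j + 2^-1 *: u k).
    rewrite -{2}half1; apply: convex_setE => //; try lra.
    - exact: (uP j).1.
    - exact: (uP k).1.
  have -> : x - (2^-1 *: u j + 2^-1 *: u k) =
            2^-1 *: ((x - u j) + (x - u k)).
    rewrite scalerDr !scalerBr addrACA -opprD -scalerDl.
    by rewrite (_ : 2^-1 + 2^-1 = 1 :> R) ?scale1r//; lra.
  rewrite normrZ exprMn gtr0_norm// (sqr_normD (x - u j)).
  have -> : u j - u k = (x - u k) - (x - u j).
    by rewrite opprB [RHS]addrC addrA subrK.
  rewrite (sqr_normB (x - u k)) (inner_sym (x - u k)).
  have := (uP j).2; have := (uP k).2.
  move: (inf D) (`|x - u k| ^+ 2 : R) (`|x - u j| ^+ 2 : R).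
  move: (inner _ _ : R) (j.+1%:R^-1 : R) (k.+1%:R^-1 : R) => i v w s p q.
  lra.
have /cauchy_seq_cvg/cvg_ex[p up] :
    forall e, 0 < e -> exists N, forall k, (N <= k)%N -> `|u N - u k| < e.
  move=> e e0; have e2 : 0 < e ^+ 2 / 4 by rewrite divr_gt0// exprn_gt0.
  have [N _ NP] := near_infty_natSinv_lt (PosNum e2).
  exists N => k Nk; rewrite -(@ltr_pXn2r _ 2)// ?nnegrE ?(ltW e0)//.
  apply: le_lt_trans (uuk N k) _.
  have /= := NP N (leqnn N); have /= := NP k Nk.
  move: (N.+1%:R^-1 : R) (k.+1%:R^-1 : R) (e ^+ 2) => s t v; lra.
exists p; split.
  apply: (@closed_cvg _ _ \oo _ u) up => //.
  by apply: nearW => n; exact: (uP n).1.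
move=> a Aa; rewrite -(@ler_pXn2r _ 2)// ?nnegrE//.
apply: le_trans (Dlb _ Aa).
have xup : `|x - u n| @[n --> \oo] --> `|x - p|.
  by apply: cvg_norm; apply: cvgB => //; exact: cvg_cst.
(* Pass to the limit in [|x - u n| ^+ 2 - n.+1%:R^-1 <= inf D]. *)
rewrite -[leLHS]subr0.
apply: (cvgr_to_le (cvgB (cvgM xup xup) (cvg_harmonic (R := R)))).
by apply: nearW => n; rewrite lerBlDr; apply/ltW; exact: (uP n).2.
Qed.

(** * Metric projections and reflections *)

Section proj.
Variable A : set H.
Hypotheses (A0 : A !=set0) (clA : closed A) (cA : convex_set A).

Lemma projP x : nearest_points A x (proj A x).
Proof.
by have [p pP] := nearest_points_neq0 x A0 clA cA; apply: xgetPex; exists p.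
Qed.

Lemma mem_proj x : A (proj A x).
Proof. exact: (projP x).1. Qed.

Lemma proj_id x : A x -> proj A x = x.
Proof.
move=> /(projP x).2; rewrite subrr normr0 normr_le0 subr_eq0.
by move/eqP.
Qed.

Lemma proj_obtuse x a : A a -> inner (x - proj A x) (a - proj A x) <= 0.
Proof.
move=> Aa; set p := proj A x; rewrite leNgt; apply/negP.
set s : R := inner _ _ => s0; set b : R := `|a - p| ^+ 2.
have b0 : 0 <= b by rewrite sqr_ge0.
have sb0 : 0 < s + b by lra.
(* Moving from [p] towards [a] by the fraction [l] must not come closer to [x], so [2 * s <= l * b];
   this [l] lies in ]0, 1] and keeps [l * b <= s], a contradiction. *)
pose l := s / (s + b).
have l0 : 0 < l by rewrite divr_gt0.
have l1 : l <= 1 by rewrite ler_pdivrMr// mul1r; lra.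
have := (projP x).2 _ (convex_setE cA (ltW l0) l1 Aa (mem_proj x)).
rewrite -/p (_ : x - (l *: a + _) = (x - p) - l *: (a - p)); last first.
  by rewrite scalerBl scale1r scalerBr addrCA opprD addrA.
rewrite -(@ler_pXn2r _ 2)// ?nnegrE// (sqr_normB (x - p)) linearZr_LR /=.
rewrite normrZ exprMn (gtr0_norm l0) -/s -/b => h.
have : 2 * s <= l * b by nra.
have : l * b <= s by rewrite /l mulrAC ler_pdivrMr//; nra.
lra.
Qed.

(** Sum of the obtuse angle inequalities at the two projections, each tested against the other
    projection. *)
Lemma proj_monotone x y :
  `|proj A x - proj A y| ^+ 2 <= inner (proj A x - proj A y) (x - y).
Proof.
have := proj_obtuse x (mem_proj y); have := proj_obtuse y (mem_proj x).
set p := proj A x; set q := proj A y.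
rewrite -innerE !(linearBl, linearBr) /=.
rewrite (inner_sym x p) (inner_sym x q) (inner_sym y p) (inner_sym y q).
rewrite (inner_sym q p).
lra.
Qed.

Lemma reflection_nonexpansive x y :
  `|reflection A x - reflection A y| <= `|x - y|.
Proof.
rewrite -(@ler_pXn2r _ 2)// ?nnegrE//.
have -> : reflection A x - reflection A y =
          2 *: (proj A x - proj A y) - (x - y).
  by rewrite /reflection scalerBr !opprD addrACA.
rewrite sqr_normB linearZl_LR /= normrZ exprMn gtr0_norm//.
have := proj_monotone x y.
set i : R := inner _ _; set j : R := `|_| ^+ 2; set k : R := `|_| ^+ 2.
clearbody i j k; lra.
Qed.

Lemma reflection_id x : A x -> reflection A x = x.
Proof.
by move=> /proj_id xE; rewrite /reflection xE scaler_nat mulr2n addrK.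
Qed.

End proj.

(** * The two-set Douglas-Rachford operator *)

Section DR.
Variables A B : set H.
Hypotheses (A0 : A !=set0) (clA : closed A) (cA : convex_set A).
Hypotheses (B0 : B !=set0) (clB : closed B) (cB : convex_set B).

(** [DR A B] averages the identity with a nonexpansive map. By the parallelogram law the left-hand
    side is the mean of [|x - y| ^+ 2] and [|v - w| ^+ 2], where [v] and [w] are the images under
    that map. *)
Lemma DR_firmly_nonexpansive x y :
  `|DR A B x - DR A B y| ^+ 2 + `|(x - DR A B x) - (y - DR A B y)| ^+ 2
    <= `|x - y| ^+ 2.
Proof.
have := le_trans (reflection_nonexpansive B0 clB cB _ _)
                 (reflection_nonexpansive A0 clA cA x y).
rewrite /DR; set v := reflection B _; set w := reflection B _.
rewrite -(@ler_pXn2r _ 2)// ?nnegrE//.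
have -> : 2^-1 *: (x + v) - 2^-1 *: (y + w) = 2^-1 *: ((x - y) + (v - w)).
  by rewrite -scalerBr opprD addrACA.
have -> : (x - 2^-1 *: (x + v)) - (y - 2^-1 *: (y + w)) =
          2^-1 *: ((x - y) - (v - w)).
  have half z z' : z - 2^-1 *: (z + z') = 2^-1 *: (z - z').
    rewrite scalerDr scalerBr opprD addrA; congr (_ - _).
    by rewrite -{1}[z]scale1r -scalerBl; congr (_ *: _); lra.
  by rewrite !half -scalerBr; congr (_ *: _); rewrite !opprD addrACA.
rewrite !normrZ !exprMn gtr0_norm// (sqr_normB (x - y)) (sqr_normD (x - y)).
set i : R := inner _ _; set j : R := `|_| ^+ 2; set k : R := `|_| ^+ 2.
clearbody i j k; lra.
Qed.

Lemma DR_nonexpansive x y : `|DR A B x - DR A B y| <= `|x - y|.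
Proof.
rewrite -(@ler_pXn2r _ 2)// ?nnegrE//.
by apply: le_trans (DR_firmly_nonexpansive x y); rewrite lerDl sqr_ge0.
Qed.

Lemma DR_id x : A x -> B x -> DR A B x = x.
Proof.
move=> Ax Bx; rewrite /DR !reflection_id//.
by rewrite -mulr2n -(scaler_nat 2 x) scalerA mulVf// scale1r.
Qed.

Lemma DR_strict x z : A z -> B z -> `|x - z| <= `|DR A B x - z| ->
  DR A B x = x.
Proof.
move=> Az Bz le_xz; have := DR_firmly_nonexpansive x z.
rewrite (DR_id Az Bz) subrr subr0.
rewrite -(@ler_pXn2r _ 2) ?nnegrE// in le_xz => h.
have : `|x - DR A B x| ^+ 2 <= 0 by lra.
by rewrite exprn_even_le0//= normr_eq0 subr_eq0 => /eqP.
Qed.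

(* With p = proj A x and n = x - p, a fixed point satisfies
   p = proj B (p - n), so n is normal at p to A and -n to B: the functional
   inner n is constant on A `&` B, hence n = 0 when A `&` B has an
   interior point. *)
Lemma DR_fixed x : (A `&` B)° !=set0 -> DR A B x = x -> A x /\ B x.
Proof.
move=> [c /nbhs_ballP[e /= e0 ce]] fix_x.
set p := proj A x; set n := x - p.
have RAx : reflection A x = p - n.
  by rewrite /reflection /n -/p scaler_nat mulr2n opprB addrA.
have pB : proj B (p - n) = p.
  (* As [x = p + n], the projection of [p - n] onto [B] is the midpoint [p] of [p - n] and its
     reflection. *)
  have : reflection B (p - n) = x.
    move: fix_x; rewrite /DR RAx => /(congr1 ( *:%R (2 : R))).
    rewrite scalerA mulfV// scale1r [RHS]scaler_nat mulr2n.
    by move/addrI.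
  rewrite /reflection /n opprB => /(congr1 (+%R^~ (p + (p - x)))).
  rewrite subrK [p + _]addrC addrA [x + _]addrC subrK -mulr2n -(scaler_nat 2 p).
  by move/(scalerI (_ : (2 : R) != 0)); apply.
have orth z : A z -> B z -> inner n (z - p) = 0.
  move=> Az Bz; apply/eqP; rewrite eq_le.
  rewrite (proj_obtuse A0 clA cA x Az) /=.
  have := proj_obtuse B0 clB cB (p - n) Bz.
  by rewrite pB addrAC subrr add0r linearNl /= oppr_le0.
have n0 : n = 0.
  apply/eqP/contraT => nn0.
  have nn : 0 < `|n| by rewrite normr_gt0.
  have [Ac Bc] : (A `&` B) c by apply: ce; exact: ballxx.
  pose s := e / 2 / `|n|.
  have s0 : 0 < s by rewrite !divr_gt0.
  have [Ad Bd] : (A `&` B) (c + s *: n).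
    apply: ce; rewrite -ball_normE /= opprD addNKr normrN normrZ gtr0_norm//.
    by rewrite divfK ?gt_eqF//; lra.
  have := orth _ Ad Bd; rewrite addrAC linearDr /= (orth _ Ac Bc) add0r.
  rewrite linearZr_LR /= innerE => /eqP.
  by rewrite mulf_eq0 (gt_eqF s0) expf_eq0 /= normr_eq0 (negPf nn0).
have -> : x = p by apply/eqP; rewrite -subr_eq0 -/n n0.
split; first exact: mem_proj.
by rewrite -pB; exact: mem_proj.
Qed.

End DR.

(** * Fejer monotone sequences and limits of iterations *)

(* Testing against z = c - s *: (u k - u j), with s chosen so that z stays in
   a ball around c contained in S, bounds the increment |u k - u j| by the
   decrease of |u - c|^2. *)
Lemma fejer_interior_cvg S u : S° !=set0 ->
  (forall z, S z -> forall k, `|u k.+1 - z| <= `|u k - z|) -> cvgn u.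
Proof.
move=> [c /nbhs_ballP[e /= e0 ce]] fejer.
have mono z j k : S z -> (j <= k)%N -> `|u k - z| <= `|u j - z|.
  move=> Sz; elim: k => [|k IH]; first by rewrite leqn0 => /eqP ->.
  rewrite leq_eqVlt => /predU1P[->//|]; rewrite ltnS => /IH.
  exact: le_trans (fejer _ Sz k).
pose a k := `|u k - c| ^+ 2.
have incr j k : (j <= k)%N -> e * `|u j - u k| <= a j - a k.
  move=> jk; have [->|neq] := eqVneq (u j) (u k).
    rewrite subrr normr0 mulr0 subr_ge0 ler_pXn2r ?nnegrE//.
    by apply: mono jk; apply: ce; exact: ballxx.
  set d := u k - u j.
  have dn : 0 < `|d| by rewrite normr_gt0 subr_eq0 eq_sym.
  pose s := e / 2 / `|d|.
  have s0 : 0 < s by rewrite !divr_gt0.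
  have sd : s * `|d| = e / 2 by rewrite divfK ?gt_eqF.
  have Sz : S (c - s *: d).
    apply: ce; rewrite -ball_normE /= opprB addrC subrK.
    by rewrite normrZ gtr0_norm// sd; lra.
  have : `|u k - (c - s *: d)| ^+ 2 <= `|u j - (c - s *: d)| ^+ 2.
    by rewrite ler_pXn2r ?nnegrE//; exact: mono Sz jk.
  rewrite !opprB.
  rewrite !(addrC (s *: d)) !addrA (sqr_normD (u k - c)) (sqr_normD (u j - c)).
  rewrite -/(a j) -/(a k).
  rewrite !(linearZr_LR inner _ s d) /=.
  have -> : inner (u k - c) d = inner (u j - c) d + `|d| ^+ 2.
    by rewrite -innerE -linearDl /= addrAC [u j + d]addrC subrK.
  have : s * `|d| ^+ 2 = e / 2 * `|d| by rewrite expr2 mulrA sd.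
  rewrite (distrC (u j)) -/d.
  move: (inner _ _ : R) (`|d| ^+ 2 : R) (`|s *: d| ^+ 2 : R) => i q t.
  move: (a j) (a k) => aj ak.
  lra.
have ainf : has_inf (range a).
  split; first by exists (a 0%N), 0%N.
  by exists 0 => _ [k _ <-]; rewrite sqr_ge0.
apply: cauchy_seq_cvg => r r0.
(* A decrease of [a] below [e * r] makes the increment smaller than [r]. *)
have er0 : 0 < e * r by rewrite mulr_gt0.
have [_ [N _ <-] aN] := inf_adherent er0 ainf.
exists N => k Nk; rewrite -(ltr_pM2l e0); apply: le_lt_trans (incr _ _ Nk) _.
have : inf (range a) <= a k by apply: (ge_inf ainf.2); exists k.
lra.
Qed.

Lemma nonexpansive_iter_limit (T : H -> H) u (l : H) :
  (forall a b, `|T a - T b| <= `|a - b|) -> (forall k, u k.+1 = T (u k)) ->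
  u k @[k --> \oo] --> l -> T l = l.
Proof.
move=> Tne uS ul.
have : T (u k) @[k --> \oo] --> T l.
  apply/cvgrPdist_le => e e0; have /cvgrPdist_le/(_ e e0) := ul.
  by apply: filterS => k; exact: le_trans.
have : T (u k) @[k --> \oo] --> l.
  by rewrite -(funext uS) cvg_shiftS.
by move=> ul' Tul; apply: norm_cvg_unique Tul ul'.
Qed.

(** * Strings of Douglas-Rachford steps *)

Section string.
Variables (m : nat) (C : 'I_m -> set H).
Hypotheses (Cclosed : forall i, closed (C i)).
Hypotheses (Cconvex : forall i, convex_set (C i)).
Hypotheses (Cint : (\bigcap_i C i)° !=set0).

Let C0 i : C i !=set0.
Proof. by have [c /interior_subset cC] := Cint; exists c; exact: cC. Qed.

Let T y (ij : 'I_m * 'I_m) := DR (C ij.1) (C ij.2) y.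

Let foldl_DR_nonexpansive l x y : `|foldl T x l - foldl T y l| <= `|x - y|.
Proof.
elim: l x y => //= ij l IH x y.
by apply: le_trans (IH _ _) _; exact: DR_nonexpansive.
Qed.

Let foldl_DR_id l z : (\bigcap_i C i) z -> foldl T z l = z.
Proof.
move=> Cz; elim: l => //= ij l IH.
by rewrite [T z ij]DR_id//; exact: Cz.
Qed.

(** The later steps cannot increase the distance to [z], so the first one does not decrease it and
    hence fixes [x]; the remaining steps then start from [x] again. *)
Let foldl_DR_strict l x z ij : (\bigcap_i C i) z ->
  `|x - z| <= `|foldl T x l - z| -> ij \in l -> T x ij = x.
Proof.
move=> Cz; elim: l x => //= kl l IH x le_x.
have Tx : T x kl = x.
  apply: (DR_strict _ _ _ _ _ _ (Cz kl.1 I) (Cz kl.2 I)) => //.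
  apply: le_trans le_x _.
  by rewrite -{1}(foldl_DR_id l Cz); exact: foldl_DR_nonexpansive.
by rewrite inE => /predU1P[->//|]; apply: IH; rewrite Tx in le_x.
Qed.

Lemma string_DR_nonexpansive s x y :
  `|string_DR C s x - string_DR C s y| <= `|x - y|.
Proof. exact: foldl_DR_nonexpansive. Qed.

Lemma string_DR_id s z : (\bigcap_i C i) z -> string_DR C s z = z.
Proof. exact: foldl_DR_id. Qed.

Lemma string_DR_strict s x z i : (\bigcap_i C i) z ->
  `|x - z| <= `|string_DR C s x - z| -> i \in s -> C i x.
Proof.
move=> Cz le_x; have size_rot1 : size s = size (rot 1 s) by rewrite size_rot.
(* Since the pairs close up cyclically, every index of [s], even the last, is the first component of
   some pair. *)
rewrite -{1}(unzip1_zip (eq_leq size_rot1)) => /mapP[[j k] jk ->] /=.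
have /= Tx := foldl_DR_strict Cz le_x jk.
apply: (DR_fixed _ _ _ _ _ _ _ Tx).1 => //.
have [c Cc] := Cint; exists c; apply: interiorS Cc => y Cy.
by split; exact: Cy.
Qed.

End string.

End Hilbert.

(** * Averaging and strong convergence *)

(** The nonnegative terms [w i * (c - f i)] have a sum at most 0, so all of them vanish. *)
Lemma le_weighted_mean (R : realDomainType) (I : finType) (w f : I -> R)
    (c : R) :
  (forall i, 0 < w i) -> \sum_i w i = 1 -> (forall i, f i <= c) ->
  c <= \sum_i w i * f i -> forall i, c <= f i.
Proof.
move=> w0 w1 fc cf i.
have : \sum_i w i * (c - f i) = 0.
  apply/eqP; rewrite eq_le sumr_ge0 ?andbT; last first.
    by move=> j _; rewrite mulr_ge0 ?subr_ge0// ltW.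
  under eq_bigr do rewrite mulrBr.
  by rewrite sumrB -mulr_suml w1 mul1r subr_le0.
move/eqP; rewrite psumr_eq0; last first.
  by move=> j _; rewrite mulr_ge0 ?subr_ge0// ltW.
move/allP/(_ i (mem_index_enum i)); rewrite /= mulf_eq0 (gt_eqF (w0 i)) /=.
by rewrite subr_eq0 => /eqP ->.
Qed.

Theorem theorem18 (R : realType) (H : hilbertType R)
    (m : nat) (C : 'I_m -> set H)
    (Cclosed : forall i, closed (C i))
    (Cconvex : forall i, convex_set (C i))
    (Cint : (\bigcap_i C i)° !=set0)
    (M : nat) (str : 'I_M -> seq 'I_m)
    (str_neq0 : forall t, str t != [::])
    (str_uniq : forall t, uniq (str t))
    (str_cover : \bigcup_t [set` str t] = [set: 'I_m])
    (w : 'I_M -> R)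
    (w_gt0 : forall t, 0 < w t)
    (w_sum1 : \sum_t w t = 1)
    (x : nat -> H)
    (xS : forall k, x k.+1 = \sum_t w t *: string_DR C (str t) (x k)) :
  exists2 xstar : H, (\bigcap_i C i) xstar & x k @[k --> \oo] --> xstar.
Proof.
pose T y := \sum_t w t *: string_DR C (str t) y.
have Tsub y z : `|T y - T z| <=
    \sum_t w t * `|string_DR C (str t) y - string_DR C (str t) z|.
  rewrite -sumrB; apply: le_trans (ler_norm_sum _ _ _) _.
  by apply: ler_sum => t _; rewrite -scalerBr normrZ gtr0_norm.
have Tne y z : `|T y - T z| <= `|y - z|.
  apply: le_trans (Tsub y z) _; rewrite -[leRHS]mul1r -w_sum1 mulr_suml.
  by apply: ler_sum => t _; rewrite ler_pM2l//; exact: string_DR_nonexpansive.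
have Tid z : (\bigcap_i C i) z -> T z = z.
  move=> Cz; rewrite /T; under eq_bigr do rewrite string_DR_id//.
  by rewrite -scaler_suml w_sum1 scale1r.
have /cvg_ex[l xl] : cvgn x.
  apply: (fejer_interior_cvg Cint) => z Cz k.
  by rewrite xS -{1}(Tid _ Cz); exact: Tne.
exists l => // i _.
have Tl : T l = l by exact: nonexpansive_iter_limit Tne xS xl.
have [c /interior_subset Cc] := Cint.
have [t _ it] : (\bigcup_t [set` str t]) i by rewrite str_cover.
apply: (string_DR_strict Cclosed Cconvex Cint Cc _ it).
pose f t := `|string_DR C (str t) l - c|.
apply: (le_weighted_mean w_gt0 w_sum1 (f := f)).
  move=> t'; rewrite /f -{1}(string_DR_id Cclosed Cconvex Cint (str t') Cc).
  exact: string_DR_nonexpansive.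
(* As [T] fixes both [l] and [c], the triangle inequality bounds [|l - c|] by the weighted mean of
   [f]. *)
rewrite -{1}Tl -{1}(Tid _ Cc); apply: le_trans (Tsub _ _) _.
by under eq_bigr do rewrite (string_DR_id _ _ _ _ Cc)//.
Qed.
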